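(* Let $\Gamma$ be a digraph of degree $d\ge 1$ that is not tight, and let $\{m\Gamma:\ m\ge 1\}$ be the family of its dilates. Then the tightness $t(d,m\Gamma)$ worsens as $m$ grows, i.e. $t(d,(m+1)\Gamma)>t(d,m\Gamma)$ for every integer $m\geq 1$.
   Context: In this context ''digraph'' means a Cayley digraph $\Gamma=\mathrm{Cay}(G,T)$ of a finite Abelian group $G$ with respect to a generating set $T\subset G$ with $0\notin T$: its vertex set is $G$ and its arcs are $g\to g+t$ for $g\in G$, $t\in T$. Its order is $\mathrm{ord}(\Gamma)=|\Gamma|=|G|$, its degree is $\deg(\Gamma)=|T|$, and $k(\Gamma)$ denotes its (directed) diameter. The solid density of a digraph $\Gamma$ of degree $d$ and order $n$ is $\delta(\Gamma)=\dfrac{n}{(k(\Gamma)+d)^d}$, and $\Delta_d=\sup\{\delta(\Gamma):\ \deg(\Gamma)=d\}$ (a finite positive real number). Put $\ell(d,n)=\left\lceil\sqrt[d]{n/\Delta_d}\,\right\rceil-d$. The tightness of a digraph $\Gamma$ of degree $d$ and order $n$ is $t(d,\Gamma)=k(\Gamma)-\ell(d,n)$ (always $\ge 0$), and $\Gamma$ is called tight when $t(d,\Gamma)=0$. Dilates: let $\Gamma=\mathrm{Cay}(G,\{g_1,\dots,g_d\})$ be a digraph of degree $d$, and let $M\in\mathbb{Z}^{d\times d}$ be a matrix whose columns form a basis of the kernel lattice of $\mathbb{Z}^d\to G$, $(a_1,\dots,a_d)\mapsto\sum_i a_ig_i$. Let $\mathrm{diag}(s_1,\dots,s_d)=UMV$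 be a Smith normal form decomposition ($U,V$ unimodular, $s_1\mid\cdots\mid s_d$). Then $\Gamma\cong\mathrm{Cay}(\mathbb{Z}^d/M\mathbb{Z}^d,\{e_1,\dots,e_d\})\cong\mathrm{Cay}(\mathbb{Z}_{s_1}\oplus\cdots\oplus\mathbb{Z}_{s_d},\{Ue_1,\dots,Ue_d\})$, where $e_1,\dots,e_d$ is the canonical basis of $\mathbb{Z}^d$; the set $\{Ue_1,\dots,Ue_d\}$ is called a proper generating set. For an integer $m\ge 1$, the dilate $m\Gamma$ is $m\Gamma=\mathrm{Cay}(\mathbb{Z}_{ms_1}\oplus\cdots\oplus\mathbb{Z}_{ms_d},\{Ue_1,\dots,Ue_d\})\cong\mathrm{Cay}(\mathbb{Z}^d/mM\mathbb{Z}^d,\{e_1,\dots,e_d\})$, a digraph of degree $d$ and order $m^d|\Gamma|$. *)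

(* Defs.v *)
From HB Require Import structures.
From mathcomp Require Import all_boot all_order all_algebra all_fingroup.
From mathcomp Require Import boolp classical_sets reals exp.

Set Implicit Arguments.
Unset Strict Implicit.
Unset Printing Implicit Defensive.

Import Order.TTheory GRing.Theory Num.Theory.
Local Open Scope ring_scope.

Section CayleyDigraph.
Variable G : finZmodType.
Implicit Types (T : {set G}) (x y : G).

(* The group operation underlying [<<_>>] is the addition of [G]. *)
Definition cayley T : Prop := <<T>>%g = [set: G] /\ 0 \notin T.

Definition arc T : rel G := fun x y => [exists t in T, y == x + t].

(* The default value [#|G|] is only reached when there is no directed walk from
   [x] to [y]: otherwise a shortest one has fewer than [#|G|] arcs. *)
Definition dist T x y : nat :=
  \big[minn/#|G|]_(n < #|G| |
    [exists p : n.-tuple G, path (arc T) x p && (last x p == y)]) n.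

Definition diam T : nat := \max_(x : G) \max_(y : G) dist T x y.

Definition density (R : realType) T : R :=
  #|G|%:R / ((diam T + #|T|) ^ #|T|)%N%:R.

End CayleyDigraph.

Definition max_density (R : realType) (d : nat) : R :=
  sup [set r : R | exists (G : finZmodType) (T : {set G}),
                     [/\ cayley T, #|T| = d & r = density R T] ]%classic.

Definition diam_bound (R : realType) (d n : nat) : int :=
  Num.ceil ((n%:R / max_density R d) `^ (d%:R^-1)) - d%:Z.

Definition tightness (R : realType) (d : nat) (G : finZmodType) (T : {set G}) :
    int :=
  (diam T)%:Z - diam_bound R d #|G|.

Definition tight (R : realType) (d : nat) (G : finZmodType) (T : {set G}) :
    Prop :=
  tightness R d T = 0.

Definition kernel_basis (d : nat) (G : finZmodType) (g : 'I_d -> G)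
    (M : 'M[int]_d) : Prop :=
  (forall a : 'cV[int]_d,
     \sum_i g i *~ a i 0 = 0 <-> exists c : 'cV[int]_d, a = M *m c) /\
  (forall c : 'cV[int]_d, M *m c = 0 -> c = 0).

Definition smith_form (d : nat) (U M V : 'M[int]_d) (s : 'I_d -> nat) : Prop :=
  [/\ U \in unitmx, V \in unitmx,
      \matrix_(i, j) ((s i)%:Z *+ (i == j)) = U *m M *m V
    & forall i j : 'I_d, (i <= j)%N -> (s i %| s j)%N].

(* [cyclic_sum n] is the direct sum of the groups Z/(n i), for positive [n i].
   Here Z/(n i) is ['I_(n i).-1.+1] rather than ['Z_(n i)], which would be Z/2
   when [n i = 1]. *)
Definition cyclic_sum (d : nat) (n : 'I_d -> nat) : Type :=
  {dffun forall i : 'I_d, 'I_(n i).-1.+1}.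

Section CyclicSum.
Variables (d : nat) (n : 'I_d -> nat).
Local Notation S := (cyclic_sum n).

HB.instance Definition _ := Finite.on S.

Definition cyclic_sum_zero : S := [ffun i => 0].
Definition cyclic_sum_opp (x : S) : S := [ffun i => - x i].
Definition cyclic_sum_add (x y : S) : S := [ffun i => x i + y i].

Fact cyclic_sum_addA : associative cyclic_sum_add.
Proof. by move=> x y z; apply/ffunP => i; rewrite !ffunE addrA. Qed.
Fact cyclic_sum_addC : commutative cyclic_sum_add.
Proof. by move=> x y; apply/ffunP => i; rewrite !ffunE addrC. Qed.
Fact cyclic_sum_add0 : left_id cyclic_sum_zero cyclic_sum_add.
Proof. by move=> x; apply/ffunP => i; rewrite !ffunE add0r. Qed.
Fact cyclic_sum_addN : left_inverse cyclic_sum_zero cyclic_sum_opp cyclic_sum_add.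
Proof. by move=> x; apply/ffunP => i; rewrite !ffunE addNr. Qed.

HB.instance Definition _ := GRing.isZmodule.Build S
  cyclic_sum_addA cyclic_sum_addC cyclic_sum_add0 cyclic_sum_addN.

(* [Zp1] is the residue class of 1, also when [n i = 1]. *)
Definition cyclic_class (a : 'cV[int]_d) : S := [ffun i => Zp1 *~ a i 0].

End CyclicSum.

(* Vertex group and generating set of the dilate of factor [m]; the generators
   [U e_j] are the columns of [U]. *)
Definition dilate_group (d : nat) (s : 'I_d -> nat) (m : nat) : finZmodType :=
  cyclic_sum (fun i => m * s i)%N.

Definition dilate_gens (d : nat) (s : 'I_d -> nat) (U : 'M[int]_d) (m : nat) :
    {set dilate_group s m} :=
  [set cyclic_class (fun i => m * s i)%N (col j U) | j : 'I_d].

(* Main.v *)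
Require Import Defs.
From HB Require Import structures.
From mathcomp Require Import all_boot all_order all_algebra all_fingroup.
From mathcomp Require Import boolp classical_sets reals exp.
From mathcomp Require Import ring zify.

Set Implicit Arguments.
Unset Strict Implicit.
Unset Printing Implicit Defensive.

Import Order.TTheory GRing.Theory Num.Theory.
Local Open Scope ring_scope.

(* Let [L] be the lattice of relations between the generators. Dividing the
   coordinates of an integer vector by [m] shows that every class modulo [m L]
   has a nonnegative representative of weight at most [m k + d (m - 1)] as soon
   as every class modulo [L] has one of weight at most [k], and vectors congruent
   to [(-1, ..., -1)] modulo [m] show that this is optimal. So [diam + d] gets
   multiplied by [m], and so does [(order / max_density) ^ (1 / d)]. With [K] and
   [x] these two quantities for the given digraph, the tightness of the dilate is
   [m K - ceil (m x)]. Now [x <= K], and non-tightness means [K <> ceil x], whence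
   [x <= K - 1], so that a further [K - x >= 1] is gained at each step. *)

(** * Walks, multiplicities of generators and the diameter *)

(** As the group is commutative, the end of a walk depends only on how often each generator is used,
    and translation reduces all walks to walks from [0]. So this amounts to a bound [k] on the
    diameter, with every vertex reachable. *)
Definition covers d (G : finZmodType) (g : 'I_d -> G) (k : nat) : Prop :=
  forall h : G, exists2 b : 'I_d -> nat,
    h = \sum_i g i *+ b i & (\sum_i b i <= k)%N.

Lemma arcP (G : finZmodType) (T : {set G}) (x y : G) :
  reflect (exists2 t, t \in T & y = x + t) (Defs.arc T x y).
Proof.
by apply: (iffP exists_inP) => -[t tT]; [move/eqP| move=> ->]; exists t.
Qed.

Lemma sum_seq_count d (G : zmodType) (g : 'I_d -> G) (l : seq 'I_d) :
  \sum_(i <- l) g i = \sum_i g i *+ count_mem i l.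
Proof.
elim: l => [|j l IHl]; first by rewrite big_nil big1.
rewrite big_cons IHl; under [RHS]eq_bigr => i _ do rewrite /= mulrnDr.
rewrite big_split /=; congr (_ + _).
by rewrite (bigD1 j) //= eqxx big1 ?addr0 // => i /negPf; rewrite eq_sym => ->.
Qed.

Lemma size_sum_count d (l : seq 'I_d) : size l = (\sum_i count_mem i l)%N.
Proof.
elim: l => [|j l IHl] /=; first by rewrite big1.
rewrite big_split -IHl /= (bigD1 j) //= eqxx big1 // => i /negPf.
by rewrite eq_sym => ->.
Qed.

Lemma multiset_seq d (b : 'I_d -> nat) :
  exists l : seq 'I_d, forall i, count_mem i l = b i.
Proof.
exists (flatten [seq nseq (b i) i | i <- enum 'I_d]) => i.
rewrite count_flatten -map_comp sumnE big_map big_enum /= (bigD1 i) //=.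
rewrite count_nseq /= eqxx mul1n big1 ?addn0 // => j /negPf ji.
by rewrite count_nseq /= ji.
Qed.

Section Walks.
Variables (d : nat) (G : finZmodType) (g : 'I_d -> G).
Let T : {set G} := [set g i | i : 'I_d].

Lemma walk_of_seq (l : seq 'I_d) (x : G) :
  exists2 p, path (Defs.arc T) x p & size p = size l /\ last x p = x + \sum_(i <- l) g i.
Proof.
elim: l x => [|i l IHl] x; first by exists [::]; rewrite // big_nil addr0.
have [p pp [sp lp]] := IHl (x + g i).
exists (x + g i :: p) => /=; last by rewrite sp lp big_cons addrA.
by rewrite pp andbT; apply/arcP; exists (g i) => //; apply: imset_f.
Qed.

Lemma seq_of_walk (p : seq G) (x : G) :
  path (Defs.arc T) x p ->
  exists2 l : seq 'I_d, size l = size p & last x p = x + \sum_(i <- l) g i.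
Proof.
elim: p x => [|y p IHp] x /=; first by exists [::]; rewrite // big_nil addr0.
case/andP => /arcP [_ /imsetP [i _ ->] ->] /IHp [l sl ->].
by exists (i :: l); rewrite /= ?sl // big_cons addrA.
Qed.

(** Removing cycles leaves a walk without repeated vertices, hence with fewer than [#|G|] arcs. The
    strict bound records that [dist] is not at its default value. *)
Lemma dist_le_walk (x : G) (p : seq G) :
  path (Defs.arc T) x p -> (dist T x (last x p) <= size p)%N /\
  (dist T x (last x p) < #|G|)%N.
Proof.
case/shortenP => p' pp' up' sub.
have lt : (size p' < #|G|)%N.
  by rewrite -[(size p').+1]/(size (x :: p')) -(card_uniqP up') max_card.
have le : (dist T x (last x p') <= size p')%N.
  apply: (@bigmin_inf _ nat _ _ (Ordinal lt)); last exact: leqnn.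
  by apply/existsP; exists (in_tuple p'); rewrite pp' eqxx.
split; last exact: leq_ltn_trans lt.
apply: (leq_trans le); apply: uniq_leq_size sub.
by case/andP: up'.
Qed.

Lemma walk_of_dist (x y : G) : (dist T x y < #|G|)%N ->
  exists2 p, path (Defs.arc T) x p & size p = dist T x y /\ last x p = y.
Proof.
rewrite /dist; set P := fun n : 'I__ => _; set D := bigop _ _ _ => lt.
(* As [D <= D], either the default [#|G|] is at most [D], which [lt] excludes, or the length [n] of
   an actual walk is. *)
have /(@bigmin_leP _ nat) [|[n /existsP [p /andP[pp /eqP lp]] le]] := leqnn D.
  by rewrite leEnat leqNgt lt.
exists p => //; split=> //; rewrite size_tuple; apply/eqP; rewrite eqn_leq.
rewrite [X in X && _]le /=.
apply: (@bigmin_le_cond _ nat).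
by apply/existsP; exists p; rewrite pp lp eqxx.
Qed.

Lemma covers_dist (k : nat) (x y : G) : covers g k ->
  (dist T x y <= k)%N /\ (dist T x y < #|G|)%N.
Proof.
move=> /(_ (y - x)) [b def_yx bk]; have [l lb] := multiset_seq b.
have [p pp [sp lp]] := walk_of_seq l x.
have lxy : last x p = y.
  rewrite lp sum_seq_count; under eq_bigr => i _ do rewrite lb.
  by rewrite -def_yx addrC subrK.
have [le lt] := dist_le_walk pp; rewrite lxy in le lt; split=> //.
apply: leq_trans le _; rewrite sp size_sum_count.
by under eq_bigr => i _ do rewrite lb.
Qed.

Lemma diam_le_covers (k : nat) : covers g k -> (diam T <= k)%N.
Proof.
move=> cov; apply/bigmax_leqP => x _; apply/bigmax_leqP => y _.
exact: (covers_dist x y cov).1.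
Qed.

(** The bound [k] makes every vertex reachable, so distances are lengths of genuine walks, and these
    supply the multiplicities. *)
Lemma covers_diam (k : nat) : covers g k -> covers g (diam T).
Proof.
move=> cov h; have /walk_of_dist [p /seq_of_walk [l sl ->] [sp lp]] :=
  (covers_dist 0 h cov).2.
exists (fun i => count_mem i l); first by rewrite -lp add0r sum_seq_count.
rewrite -size_sum_count sl sp.
apply: leq_trans (leq_bigmax (F := fun x => \max_y dist T x y) 0).
exact: (leq_bigmax (F := fun y => dist T 0 y) h).
Qed.

Lemma covers_gen : <<T>>%g = [set: G] -> exists k, covers g k.
Proof.
move=> genT.
have reprG (h : G) : exists b : 'I_d -> nat, h = \sum_i g i *+ b i.
  have: h \in <<T>>%g by rewrite genT inE.
  (* In a finite group the generated subgroup consists of products of generators, without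
     inverses. *)
  case/gen_prodgP => n [c cT ->]; elim: n c cT => [|n IHn] c cT.
    by exists (fun=> 0%N); rewrite big_ord0 big1.
  rewrite big_ord_recr /=; have [|b ->] := IHn (fun i => c (widen_ord (leqnSn n) i)).
    by move=> i; apply: cT.
  have /imsetP [j _ ->] := cT ord_max.
  exists (fun i => b i + (i == j))%N; under [RHS]eq_bigr => i _ do rewrite mulrnDr.
  rewrite big_split /= [X in _ = _ + X](bigD1 j) //= eqxx mulr1n.
  by rewrite [X in _ = _ + (_ + X)]big1 ?addr0 // => i /negPf ->.
exists (\max_(h : G) \sum_i projT1 (cid (reprG h)) i)%N => h.
exists (projT1 (cid (reprG h))); first by case: (cid _).
exact: (leq_bigmax (F := fun h => \sum_i projT1 (cid (reprG h)) i)%N h).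
Qed.

End Walks.

Lemma sumr_mulrzB d (G : zmodType) (g : 'I_d -> G) (a b : 'I_d -> int) :
  \sum_i g i *~ (a i - b i) = \sum_i g i *~ a i - \sum_i g i *~ b i.
Proof. by rewrite -sumrB; apply: eq_bigr => i _; rewrite mulrzBr. Qed.

(** * Effect on the diameter of multiplying the relation lattice by [m] *)

Section Dilation.
Variables (d : nat) (G H : finZmodType) (g : 'I_d -> G) (h : 'I_d -> H).
Variable m : nat.
Hypothesis m_gt0 : (0 < m)%N.
(* The relations between the [h i] are [m] times those between the [g i]. *)
Hypothesis kernel_dilate : forall a : 'I_d -> int,
  \sum_i h i *~ a i = 0 <->
  exists2 c : 'I_d -> int, a =1 (fun i => m%:Z * c i) & \sum_i g i *~ c i = 0.

Lemma covers_dilate (k : nat) :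
    (forall y : H, exists a : 'I_d -> int, y = \sum_i h i *~ a i) ->
  covers g k -> covers h (m * k + d * m.-1).
Proof.
move=> surj cov y; have [a ->] := surj y.
have m_neq0 : m%:Z != 0 by rewrite eqz_nat -lt0n.
have [b defb bk] := cov (\sum_i g i *~ (a i %/ m)%Z).
(* The remainders [r i] account for the summand [d * m.-1]. *)
pose r i := `|(a i %% m)%Z|%N.
have rE i : (r i)%:Z = (a i %% m)%Z by rewrite gez0_abs // modz_ge0.
have rm i : (r i <= m.-1)%N.
  by rewrite -ltnS prednK // -ltz_nat rE ltz_mod.
exists (fun i => m * b i + r i)%N; last first.
  rewrite big_split -big_distrr /=; apply: leq_add; first by rewrite leq_mul2l bk orbT.
  by rewrite -[d in (_ <= d * _)%N]card_ord -sum_nat_const; apply: leq_sum => i _.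
apply/eqP; rewrite -subr_eq0; apply/eqP.
rewrite -(sumr_mulrzB h a (fun i => (m * b i + r i)%N%:Z)); apply/kernel_dilate.
(* The vectors [a] and [m b + r] differ by [m] times [a %/ m - b], which is a relation between the
   [g i] by [defb]. *)
exists (fun i => (a i %/ m)%Z - (b i)%:Z); last by rewrite sumr_mulrzB defb subrr.
move=> i; rewrite {1}(divz_eq (a i) m) PoszD PoszM rE mulrBr mulrC opprD.
by rewrite addrACA subrr addr0.
Qed.

(* Witnessed by the vertices [m x + (m - 1, ..., m - 1)]: in every representation
   of such a vertex all multiplicities are congruent to [m - 1] modulo [m]. *)
Lemma covers_undilate (k l : nat) : covers g k -> covers h l ->
  forall x : G, exists2 b : 'I_d -> nat,
    x = \sum_i g i *+ b i & (m * (\sum_i b i) + d * m.-1 <= l)%N.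
Proof.
move=> covg covh x; have [b0 -> _] := covg x.
have [b defb bl] := covh (\sum_i h i *+ (m * b0 i + m.-1)).
have : \sum_i h i *~ ((b i)%:Z - (m * b0 i + m.-1)%N%:Z) = 0.
  by rewrite (sumr_mulrzB h (fun i => (b i)%:Z)) defb subrr.
case/kernel_dilate => c bc c0.
(* Since [b i = m (b0 i + c i) + (m - 1)], division by [m] leaves remainder [m - 1] and quotient
   [b0 i + c i]. *)
have bE i : b i = (m * (b i %/ m) + m.-1)%N /\ (b i %/ m)%N%:Z - (b0 i)%:Z = c i.
  have m_neq0 : m%:Z != 0 by rewrite eqz_nat -lt0n.
  have E : (b i)%:Z = ((b0 i)%:Z + c i) * m%:Z + m.-1%:Z.
    have /eqP := bc i; rewrite subr_eq => /eqP ->; rewrite PoszD PoszM; ring.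
  have E2 : ((b i) %/ m)%N%:Z = (b0 i)%:Z + c i.
    rewrite -divz_nat E divzMDl // divz_small ?addr0 //.
    by rewrite le0z_nat /= ltz_nat prednK.
  split; last by rewrite E2; ring.
  by apply/eqP; rewrite -eqz_nat PoszD PoszM E2 {1}E mulrC.
(* These quotients still represent [x], as they differ from [b0] by the relation [c]. *)
exists (fun i => b i %/ m)%N.
  apply/eqP; rewrite eq_sym -subr_eq0.
  rewrite -(sumr_mulrzB g (fun i => (b i %/ m)%N%:Z) (fun i => (b0 i)%:Z)).
  by rewrite -[X in _ == X]c0; apply/eqP/eq_bigr => i _; rewrite (bE i).2.
apply: leq_trans bl; rewrite big_distrr -[d in (d * _)%N]card_ord -sum_nat_const /=.
rewrite -big_split /=; apply: leq_sum => i _.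
by rewrite -(bE i).1.
Qed.

Lemma diam_dilate (k : nat) :
    (forall y : H, exists a : 'I_d -> int, y = \sum_i h i *~ a i) ->
    covers g k ->
  (diam [set h i | i : 'I_d] + d = m * (diam [set g i | i : 'I_d] + d))%N.
Proof.
move=> surj covk; have cov := covers_diam covk.
have covh := covers_dilate surj cov.
suff -> : diam [set h i | i : 'I_d] =
    (m * diam [set g i | i : 'I_d] + d * m.-1)%N.
  by rewrite -addnA -[X in (_ + X)%N]mulnSr prednK // [(d * m)%N]mulnC mulnDr.
apply/eqP; rewrite eqn_leq diam_le_covers //=.
have und := covers_undilate cov (covers_diam covh).
(* This keeps the truncated subtraction of [d * m.-1] below exact. *)
have le : (d * m.-1 <= diam [set h i | i : 'I_d])%N.
  by have [b _] := und 0; apply: leq_trans; apply: leq_addl.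
rewrite addnC -leq_subRL // mulnC -leq_divRL //.
apply: diam_le_covers => x; have [b -> bl] := und x; exists b => //.
by rewrite leq_divRL // mulnC leq_subRL // addnC.
Qed.

End Dilation.

(** * Direct sums of cyclic groups and comparison of orders *)

Lemma Zp1_mulrn p n : Zp1 *+ n = inZp n :> 'I_p.+1.
Proof.
elim: n => [|n IHn]; first by apply: val_inj; rewrite /= mod0n.
by rewrite mulrS IHn; apply: val_inj; rewrite /= modnDm.
Qed.

Lemma Zp1_mulrz_eq0 p (z : int) :
  (Zp1 *~ z == 0 :> 'I_p.+1) = (p.+1%:Z %| z)%Z.
Proof.
rewrite {1}(divz_eq z p.+1) mulrzDr [_ * p.+1%:Z]mulrC mulrzA.
have -> : Zp1 *~ p.+1 = 0 :> 'I_p.+1.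
  by rewrite -[Zp1 *~ _]/(Zp1 *+ _) Zp1_mulrn; apply: val_inj; rewrite /= modnn.
rewrite mul0rz add0r; have r_ge0 : 0 <= (z %% p.+1)%Z by apply: modz_ge0.
have lt : (`|(z %% p.+1)%Z| < p.+1)%N by rewrite -ltz_nat gez0_abs // ltz_mod.
rewrite -(gez0_abs r_ge0) -[Zp1 *~ _]/(Zp1 *+ `|_|%N) Zp1_mulrn -val_eqE /=.
by rewrite modn_small // absz_eq0; apply/eqP/dvdz_mod0P.
Qed.

Section CyclicSumTheory.
Variables (d : nat) (n : 'I_d -> nat).

Fact cyclic_class_is_zmod_morphism : zmod_morphism (@cyclic_class d n).
Proof.
by move=> a b; apply/ffunP => i; rewrite !ffunE !mxE mulrzBr.
Qed.

HB.instance Definition _ :=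
  GRing.isZmodMorphism.Build _ _ (@cyclic_class d n) cyclic_class_is_zmod_morphism.

Lemma sum_cyclic_class_col (U : 'M[int]_d) (a : 'cV[int]_d) :
  \sum_j cyclic_class n (col j U) *~ a j 0 = cyclic_class n (U *m a).
Proof.
under eq_bigr => j _ do rewrite -raddfMz.
rewrite -raddf_sum; congr cyclic_class; apply/colP => i.
rewrite summxE mxE; apply: eq_bigr => j _.
by rewrite -scaler_int !mxE intz mulrC.
Qed.

Lemma cyclic_class_surj (y : cyclic_sum n) :
  exists a : 'cV[int]_d, y = cyclic_class n a.
Proof.
exists (\col_i (y i : nat)%:Z); apply/ffunP => i.
by rewrite ffunE mxE -[Zp1 *~ _]/(Zp1 *+ _) Zp1_mulrn valZpK.
Qed.

Hypothesis n_gt0 : forall i, (0 < n i)%N.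

Lemma cyclic_class_eq0 (a : 'cV[int]_d) :
  cyclic_class n a = 0 <-> forall i, ((n i)%:Z %| a i 0%R)%Z.
Proof.
have E i : (cyclic_class n a i == 0) = ((n i)%:Z %| a i 0%R)%Z.
  by rewrite ffunE Zp1_mulrz_eq0 prednK.
split=> [a0 i | dvd]; first by rewrite -E a0 ffunE.
by apply/ffunP => i; rewrite [RHS]ffunE; apply/eqP; rewrite E.
Qed.

Lemma card_cyclic_sum : #|{: cyclic_sum n}| = (\prod_i n i)%N.
Proof.
rewrite card_dep_ffun foldrE big_image /=.
by apply: eq_bigr => i _; rewrite card_ord prednK.
Qed.

End CyclicSumTheory.

(** Write each element of [G] with integer coefficients in the [g i] and use the same coefficients
    on the [h i]. This map is injective, because a relation between the [h i] is one between the
    [g i]. *)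
Lemma leq_card_kernel d (G H : finZmodType) (g : 'I_d -> G) (h : 'I_d -> H) :
    (forall x : G, exists a : 'I_d -> int, x = \sum_i g i *~ a i) ->
    (forall a : 'I_d -> int, \sum_i h i *~ a i = 0 -> \sum_i g i *~ a i = 0) ->
  (#|G| <= #|H|)%N.
Proof.
move=> surj ker; pose rep x := projT1 (cid (surj x)).
have repE x : x = \sum_i g i *~ rep x i by rewrite /rep; case: (cid _).
apply: (@leq_card _ _ (fun x => \sum_i h i *~ rep x i)) => x y /eqP.
rewrite -subr_eq0 -sumr_mulrzB => /eqP /ker; rewrite sumr_mulrzB -!repE => /eqP.
by rewrite subr_eq0 => /eqP.
Qed.

(** * The relation lattice of a dilate, from the Smith normal form *)

Section SmithForm.
Variables (d : nat) (G : finZmodType) (g : 'I_d -> G).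
Variables (M U V : 'M[int]_d) (s : 'I_d -> nat).
Hypotheses (hM : kernel_basis g M) (hs : smith_form U M V s).

Let smith_mul (e : 'cV[int]_d) (i : 'I_d) :
  (U *m (M *m (V *m e))) i 0 = (s i)%:Z * e i 0.
Proof.
have [_ _ D _] := hs; rewrite !mulmxA -D mxE (bigD1 i) //= mxE eqxx mulr1n.
by rewrite big1 ?addr0 // => j /negPf ji; rewrite mxE eq_sym ji mul0r.
Qed.

(** If [s i] were zero, [M] would kill the [i]-th column of [V], which is nonzero, although the
    columns of [M] are independent. *)
Lemma smith_form_gt0 i : (0 < s i)%N.
Proof.
have [_ V_unit _ _] := hs; have [U_unit _ _ _] := hs.
case: (posnP (s i)) => // si0.
have: M *m (V *m delta_mx i 0) = 0 :> 'cV_d.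
  rewrite -[LHS](mulKmx U_unit).
  suff -> : U *m (M *m (V *m delta_mx i 0)) = 0 :> 'cV_d by rewrite mulmx0.
  apply/colP => j; rewrite smith_mul !mxE andbT.
  by case: eqP => [->|]; rewrite ?si0 ?mul0r ?mulr0.
move/hM.2 => Ve0; have: delta_mx i 0 = 0 :> 'cV[int]_d.
  by rewrite -[LHS](mulKmx V_unit) Ve0 mulmx0.
by move/colP/(_ i); rewrite !mxE !eqxx.
Qed.

Definition dilate_gen m (i : 'I_d) : dilate_group s m :=
  cyclic_class (fun i => m * s i)%N (col i U).

Variable m : nat.
Hypothesis m_gt0 : (0 < m)%N.

Let ms_gt0 i : (0 < m * s i)%N.
Proof. by rewrite muln_gt0 m_gt0 smith_form_gt0. Qed.

Let sum_dilate_gen (a : 'I_d -> int) :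
  \sum_i dilate_gen m i *~ a i =
  cyclic_class (fun i => m * s i)%N (U *m \col_i a i).
Proof.
by rewrite -sum_cyclic_class_col; apply: eq_bigr => i _; rewrite mxE.
Qed.

Lemma dilate_gen_surj (y : dilate_group s m) :
  exists a : 'I_d -> int, y = \sum_i dilate_gen m i *~ a i.
Proof.
have [U_unit _ _ _] := hs; have [b ->] := cyclic_class_surj y.
exists (fun i => (invmx U *m b) i 0); rewrite sum_dilate_gen.
have -> : \col_i (invmx U *m b) i 0 = invmx U *m b by apply/colP => i; rewrite mxE.
by rewrite mulKVmx.
Qed.

(** This supplies [kernel_dilate]: [U] carries the lattice generated by [m M] onto the vectors whose
    [i]-th coordinate is divisible by [m * s i], which form the kernel of [cyclic_class]. *)
Lemma dilate_gen_kernel (a : 'I_d -> int) :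
  \sum_i dilate_gen m i *~ a i = 0 <->
  exists2 c : 'I_d -> int, a =1 (fun i => m%:Z * c i) & \sum_i g i *~ c i = 0.
Proof.
have [U_unit V_unit _ _] := hs; rewrite sum_dilate_gen cyclic_class_eq0 //.
split=> [dvd | [c ac c0] i].
  pose e : 'cV[int]_d := \col_i ((U *m \col_i a i) i 0%R %/ (m * s i)%N)%Z.
  have aE : \col_i a i = m%:Z *: (M *m (V *m e)).
    rewrite -[LHS](mulKmx U_unit) -[RHS](mulKmx U_unit); congr (_ *m _).
    apply/colP => i; rewrite -scalemxAr [RHS]mxE smith_mul [e _ _]mxE.
    by rewrite mulrA -PoszM mulrC divzK.
  exists (fun i => (M *m (V *m e)) i 0).
    by move=> i; move/colP/(_ i): aE; rewrite !mxE.
  by apply/hM.1; exists (V *m e).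
have /hM.1 [u uE] : \sum_i g i *~ (\col_i c i) i 0 = 0.
  by rewrite -[RHS]c0; apply: eq_bigr => i' _; rewrite mxE.
have -> : \col_i a i = m%:Z *: (M *m (V *m (invmx V *m u))).
  by rewrite mulKVmx // -uE; apply/colP => j; rewrite !mxE.
by rewrite -scalemxAr mxE smith_mul mulrA -PoszM dvdz_mulr.
Qed.

Lemma card_dilate_group_prod : #|dilate_group s m| = (m ^ d * \prod_i s i)%N.
Proof.
rewrite [LHS](card_cyclic_sum ms_gt0) big_split /=.
by rewrite prod_nat_const card_ord.
Qed.

End SmithForm.

(** * Diameter and order of the dilates *)

Section Dilates.
Variables (d : nat) (G : finZmodType) (g : 'I_d -> G).
Variables (M U V : 'M[int]_d) (s : 'I_d -> nat).
Hypotheses (hM : kernel_basis g M) (hs : smith_form U M V s).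
Hypothesis genG : <<[set g i | i : 'I_d]>>%g = [set: G].
Variable m : nat.
Hypothesis m_gt0 : (0 < m)%N.

Lemma diam_dilate_gens :
  (diam (dilate_gens s U m) + d = m * (diam [set g i | i : 'I_d] + d))%N.
Proof.
have [k cov] := covers_gen genG.
exact: (diam_dilate m_gt0 (dilate_gen_kernel hM hs m_gt0) (@dilate_gen_surj _ _ _ _ _ hs _) cov).
Qed.

(** The product of the [s i] is the order of the dilate of factor 1, whose generators have the same
    integer relations as the [g i]; equality of orders follows from two inequalities. *)
Lemma card_dilate_group : #|dilate_group s m| = (m ^ d * #|G|)%N.
Proof.
rewrite (card_dilate_group_prod hM hs m_gt0); congr (_ * _)%N.
have := card_dilate_group_prod hM hs (ltn0Sn 0); rewrite exp1n mul1n => <-.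
have ker := dilate_gen_kernel hM hs (ltn0Sn 0).
apply/eqP; rewrite eqn_leq; apply/andP; split.
  apply: (leq_card_kernel (h := g) (@dilate_gen_surj _ _ _ _ _ hs _)) => a a0.
  by apply/ker; exists a => // i; rewrite mul1r.
apply: (leq_card_kernel (g := g) (h := dilate_gen U s 1)) => [x|a /ker [c ac c0]].
  have [k /(_ x) [b -> _]] := covers_gen genG.
  by exists (fun i => (b i)%:Z).
by rewrite -[RHS]c0; apply: eq_bigr => i _; rewrite ac mul1r.
Qed.

End Dilates.

(** * The real number behind the lower bound on the diameter *)

Section IdealSide.
Variable R : realType.

Lemma max_density_ge0 d : 0 <= max_density R d.
Proof.
rewrite /max_density; set E := mkset _.
(* On an empty or unbounded set, [sup] is 0 by default. *)
have [sE|/sup_out ->//] := pselect (has_sup E).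
have [[r Er] ubE] := sE; apply: le_trans (ub_le_sup ubE Er).
by have [G [T [_ _ ->]]] := Er; apply: divr_ge0.
Qed.

(** When [max_density] is positive, this is the value of [diam + d] at which order [n] and degree
    [d] would attain it. *)
Definition ideal_side (d n : nat) : R := (n%:R / max_density R d) `^ d%:R^-1.

(* If the densities were unbounded, [max_density] would be the junk value [0]
   and so would [ideal_side]; the inequality holds in that case too. *)
Lemma ideal_side_le d (G : finZmodType) (T : {set G}) :
    (0 < d)%N -> cayley T -> #|T| = d ->
  ideal_side d #|G| <= (diam T + d)%:R.
Proof.
move=> d_gt0 cayT cardT; rewrite /ideal_side.
have d0 : d%:R != 0 :> R by rewrite pnatr_eq0 -lt0n.
have := max_density_ge0 d; rewrite le_eqVlt => /predU1P [<-|D_gt0].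
  by rewrite invr0 mulr0 powR0 ?invr_eq0.
have K_gt0 : 0 < (diam T + d)%:R :> R by rewrite ltr0n addn_gt0 d_gt0 orbT.
have le : density R T <= max_density R d.
  apply: ub_le_sup; last by exists G, T.
  (* Without an upper bound [max_density] would be the default 0, against [D_gt0]. *)
  apply: contrapT => ub; move: D_gt0; rewrite /max_density sup_out ?ltxx //.
  by case.
have -> : (diam T + d)%:R = ((diam T + d)%:R `^ d%:R) `^ d%:R^-1 :> R.
  by rewrite -powRrM mulfV // powRr1 // ltW.
apply: ge0_ler_powR; rewrite ?nnegrE ?invr_ge0 ?powR_ge0 ?divr_ge0 ?(ltW D_gt0) //.
rewrite ler_pdivrMr // powR_mulrn ?(ltW K_gt0) // mulrC -ler_pdivrMr ?exprn_gt0 //.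
by rewrite -natrX; move: le; rewrite /density cardT.
Qed.

Lemma ideal_side_dilate d n m : (0 < d)%N ->
  ideal_side d (m ^ d * n) = m%:R * ideal_side d n.
Proof.
move=> d_gt0; have d0 : d%:R != 0 :> R by rewrite pnatr_eq0 -lt0n.
rewrite /ideal_side natrM natrX -mulrA powRM ?exprn_ge0 //; last first.
  by rewrite divr_ge0 // max_density_ge0.
by rewrite -powR_mulrn // -powRrM mulfV // powRr1.
Qed.

(** Here [(m + 1) x = m x + x] is at most the integer [ceil (m x) + K - 1], which therefore also
    bounds its ceiling. *)
Lemma ceil_mul_succ (x : R) (K : int) (m : nat) : x <= (K - 1)%:~R ->
  Num.ceil (m.+1%:R * x) < Num.ceil (m%:R * x) + K.
Proof.
move=> xK; rewrite -lezD1 -lerBrDr ceil_le_int.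
rewrite -natr1 mulrDl mul1r -addrA rmorphD /= lerD // ceil_ge //.
Qed.

End IdealSide.

Theorem theorem3 (R : realType) (d : nat) (hd : (1 <= d)%N)
    (G : finZmodType) (g : 'I_d -> G) (g_inj : injective g)
    (hcayley : cayley [set g i | i : 'I_d])
    (M U V : 'M[int]_d) (s : 'I_d -> nat)
    (hM : kernel_basis g M) (hs : smith_form U M V s)
    (hnt : ~ tight R d [set g i | i : 'I_d])
    (m : nat) (hm : (1 <= m)%N) :
  tightness R d (dilate_gens s U m) < tightness R d (dilate_gens s U m.+1).
Proof.
set K := (diam [set g i | i : 'I_d] + d)%N; pose x : R := ideal_side R d #|G|.
have tightE n : (0 < n)%N ->
    tightness R d (dilate_gens s U n) = (n * K)%N%:Z - Num.ceil (n%:R * x).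
  move=> n_gt0; have [genG _] := hcayley.
  rewrite /tightness /diam_bound (card_dilate_group hM hs genG n_gt0).
  rewrite -/(ideal_side R d _) ideal_side_dilate //.
  by rewrite -(diam_dilate_gens hM hs genG n_gt0) PoszD; ring.
(* Injectivity of [g] makes the degree exactly [d]. *)
have cardT : #|[set g i | i : 'I_d]| = d by rewrite card_imset ?card_ord.
have xK : x <= (K%:Z - 1)%:~R.
  (* Passing to [ceil x] makes the comparison one of integers: [ceil x <= K] with equality excluded
     gives [ceil x <= K - 1]. *)
  rewrite -ceil_le_int lerBrDr lezD1 lt_neqAle ceil_le_int.
  rewrite [X in _ && X](ideal_side_le _ hd hcayley cardT) andbT.
  apply/eqP => ceilK; apply: hnt.
  rewrite /tight /tightness /diam_bound -/(ideal_side R d _) -/x ceilK.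
  by rewrite PoszD; ring.
have := ceil_mul_succ m xK; rewrite !tightE // mulSn PoszD; lia.
Qed.
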